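(* Let $(M,g)$ be a pseudo-Riemannian manifold, let $\nabla$ be the Levi-Civita connection of $g$ and let $J$ be an invertible $g$-symmetric $(1,1)$-tensor field on $M$ such that $(\nabla_XJ)Y=(\nabla_YJ)X$ for all vector fields $X,Y$. Let $\tilde g(X,Y)=g(X,JY)$, let $\nabla^*$ be the dual connection of $\nabla$ with respect to $\tilde g$, and let $\nabla^{(\alpha)}=\frac{1+\alpha}{2}\nabla+\frac{1-\alpha}{2}\nabla^*$. Let $$\hat J_-=\begin{pmatrix} J & -(I+J^2)\tilde g^{-1}\\ \tilde g & -J^*\end{pmatrix}$$ be the generalized almost complex structure on $TM\oplus T^*M$ induced by $(\tilde g,J)$. Then $$N_{\hat J_-}^{\nabla^{(\alpha)}}(X+\eta,Y+\beta)=N_{\hat J_-}^{\nabla}(X+\eta,Y+\beta)$$ for all vector fields $X,Y$, all $1$-forms $\eta,\beta$ and all $\alpha\in\mathbb{R}$ if and only if the tensor field $F(X,Y,Z)=\tilde g((\nabla_XJ)Y,Z)$ satisfies $$F(Y,Z,X)-F(X,Z,Y)=0$$ for all vector fields $X,Y,Z$ on $M$.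
   Context: $J$ is $g$-symmetric if $g(JX,Y)=g(X,JY)$. The tensor $\tilde g$ is identified with the bundle isomorphism $\tilde g:TM\to T^*M$, $\tilde g(X)=\tilde g(X,\cdot)$, with inverse $\tilde g^{-1}$; $(J^*\eta)(X)=\eta(JX)$. The matrix means $\hat J_-(X+\eta)=JX-(I+J^2)\tilde g^{-1}(\eta)+\tilde g(X)-J^*\eta$. The dual connection $\nabla^*$ is defined by $X(\tilde g(Y,Z))=\tilde g(\nabla_XY,Z)+\tilde g(Y,\nabla^*_XZ)$. For an affine connection $D$ on $M$ (acting on $1$-forms by $(D_X\beta)(Y)=X(\beta(Y))-\beta(D_XY)$), the bracket on sections of $TM\oplus T^*M$ is $[X+\eta,Y+\beta]_D=[X,Y]+D_X\beta-D_Y\eta$, and the Nijenhuis tensor of an endomorphism $\hat J$ of $TM\oplus T^*M$ with respect to $D$ is $N_{\hat J}^{D}(\sigma,\tau)=[\hat J\sigma,\hat J\tau]_D-\hat J[\hat J\sigma,\tau]_D-\hat J[\sigma,\hat J\tau]_D+\hat J^2[\sigma,\tau]_D$. *)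

(* Defs.v *)
From HB Require Import structures.
From mathcomp Require Import all_boot all_order all_algebra.
From mathcomp Require Import mathcomp_extra boolp classical_sets functions reals.
From mathcomp Require Import topology normedtype derive.

Set Implicit Arguments.
Unset Strict Implicit.
Unset Printing Implicit Defensive.

From mathcomp Require Import ring.

Import Order.TTheory GRing.Theory Num.Theory.
Import numFieldNormedType.Exports.

Local Open Scope classical_set_scope.
Local Open Scope ring_scope.

Section euclidean_smoothness.
Variables (R : realType) (n : nat).

(* [is_partial i U f g]: g is the i-th partial derivative of f at every point
   of U.  Restricting to coordinate lines makes sense for n = 0 as well. *)
Definition is_partial (i : 'I_n) (U : set 'rV[R]_n) (f g : 'rV[R]_n -> R) :=
  forall x, U x ->
    is_derive (0 : R) 1 (fun t : R => f (x + t *: delta_mx 0 i)) (g x).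

Fixpoint Ck_on (k : nat) (U : set 'rV[R]_n) (f : 'rV[R]_n -> R) : Prop :=
  (forall x, U x -> {for x, continuous f}) /\
  match k with
  | 0%N => True
  | k'.+1 => forall i, exists g, is_partial i U f g /\ Ck_on k' U g
  end.

Definition smooth_on (U : set 'rV[R]_n) (f : 'rV[R]_n -> R) :=
  forall k, Ck_on k U f.

Lemma Ck_on_continuous k U f x : Ck_on k U f -> U x -> {for x, continuous f}.
Proof. by case: k => [|k] [cf _]; exact: cf. Qed.

Lemma Ck_on_pred k U f : Ck_on k.+1 U f -> Ck_on k U f.
Proof.
elim: k f => [|k IHk] f [cf df]; split => // i.
by have [g [fg Cg]] := df i; exists g; split => //; exact: IHk.
Qed.

Lemma Ck_on_cst k U a : Ck_on k U (fun=> a).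
Proof.
have ca (b : R) (x : 'rV[R]_n) : {for x, continuous (fun=> b : R)}.
  exact: (@cst_continuous 'rV[R]_n R b x).
elim: k a => [|k IHk] a; first by split => // x _; exact: ca.
split; first by move=> x _; exact: ca.
by move=> i; exists (fun=> 0); split => // x _; exact: is_derive_cst.
Qed.

Lemma Ck_onD k U f g : Ck_on k U f -> Ck_on k U g ->
  Ck_on k U (fun x => f x + g x).
Proof.
elim: k f g => [|k IHk] f g Cf Cg.
  by split => // x Ux; apply: continuousD;
    [exact: (Ck_on_continuous Cf)|exact: (Ck_on_continuous Cg)].
split => [x Ux|i].
  by apply: continuousD; [exact: (Ck_on_continuous Cf)|exact: (Ck_on_continuous Cg)].
case: Cf Cg => _ /(_ i)[f' [ff' Cf']] [_ /(_ i)[g' [gg' Cg']]].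
exists (fun x => f' x + g' x); split; last exact: IHk.
by move=> x Ux; apply: is_deriveD; [exact: ff'|exact: gg'].
Qed.

Lemma Ck_onM k U f g : Ck_on k U f -> Ck_on k U g ->
  Ck_on k U (fun x => f x * g x).
Proof.
elim: k f g => [|k IHk] f g Cf Cg.
  by split => // x Ux; apply: continuousM;
    [exact: (Ck_on_continuous Cf)|exact: (Ck_on_continuous Cg)].
split => [x Ux|i].
  by apply: continuousM; [exact: (Ck_on_continuous Cf)|exact: (Ck_on_continuous Cg)].
have [Cf0 Cg0] := (Ck_on_pred Cf, Ck_on_pred Cg).
case: Cf Cg => _ /(_ i)[f' [ff' Cf']] [_ /(_ i)[g' [gg' Cg']]].
exists (fun x => f x * g' x + g x * f' x); split; last first.
  by apply: Ck_onD; exact: IHk.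
move=> x Ux; apply: is_derive_eq (is_deriveM (ff' x Ux) (gg' x Ux)) _.
by rewrite /= scale0r addr0.
Qed.

End euclidean_smoothness.

Section charts.
Variables (R : realType) (n : nat) (M : topologicalType).

Record chart := Chart {
  chart_dom : set M;
  chart_map : M -> 'rV[R]_n;
  chart_inv : 'rV[R]_n -> M;
  chart_open : open chart_dom;
  chart_img_open : open (chart_map @` chart_dom);
  chartK : forall x, chart_dom x -> chart_inv (chart_map x) = x;
  chart_continuous : forall x, chart_dom x -> {for x, continuous chart_map};
  chart_inv_continuous : forall y, (chart_map @` chart_dom) y ->
    {for y, continuous chart_inv} }.

Definition smooth_transition (c c' : chart) :=
  forall j : 'I_n,
    smooth_on (chart_map c @` (chart_dom c `&` chart_dom c'))
              (fun y => chart_map c' (chart_inv c y) 0 j).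

End charts.

Record smooth_manifold (R : realType) (n : nat) := SmoothManifold {
  carrier :> topologicalType;
  atlas : set (chart R n carrier);
  manifold_hausdorff : hausdorff_space carrier;
  manifold_second_countable : @second_countable carrier;
  atlas_cover : forall p, exists2 c, atlas c & chart_dom c p;
  atlas_smooth : forall c c', atlas c -> atlas c' -> smooth_transition c c' }.

Section smooth_functions.
Variables (R : realType) (n : nat) (M : smooth_manifold R n).

Definition smooth (f : M -> R) :=
  forall c : chart R n M, atlas c ->
    smooth_on (chart_map c @` chart_dom c) (f \o chart_inv c).

Definition smoothb : {pred (M -> R)} := fun f => `[< smooth f >].

Record Cinf := MkCinf { Cinf_fun :> M -> R; Cinf_smooth : Cinf_fun \in smoothb }.

HB.instance Definition _ := [isSub for Cinf_fun].
HB.instance Definition _ := [Choice of Cinf by <:].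

Lemma smooth_cst a : smooth (fun=> a).
Proof. by move=> c _ k; exact: Ck_on_cst. Qed.

Lemma smoothb_subring : subring_closed smoothb.
Proof.
split; first by apply/asboolP; exact: smooth_cst.
- move=> f g /asboolP sf /asboolP sg; apply/asboolP => c Ac k.
  rewrite (_ : _ \o _ = fun y => (f \o chart_inv c) y
                              + (-1) * (g \o chart_inv c) y); last first.
    by apply/funext => y /=; rewrite mulN1r.
  apply: Ck_onD; first exact: sf.
  by apply: Ck_onM; [exact: Ck_on_cst|exact: sg].
- move=> f g /asboolP sf /asboolP sg; apply/asboolP => c Ac k.
  by apply: Ck_onM; [exact: sf|exact: sg].
Qed.
HB.instance Definition _ := GRing.isSubringClosed.Build (M -> R) smoothb
  smoothb_subring.
HB.instance Definition _ :=
  GRing.SubChoice_isSubComPzRing.Build (M -> R) smoothb Cinf smoothb_subring.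

Definition Cinf_cst (a : R) : Cinf :=
  MkCinf (introT (asboolP _) (smooth_cst a)).

End smooth_functions.

Section vector_fields.
Variables (R : realType) (n : nat) (M : smooth_manifold R n).
Local Notation C := (Cinf M).

(* Vector fields are the R-linear derivations of the algebra of smooth
   functions; tensor fields are the maps that are linear over that algebra. *)
Definition derivation (X : C -> C^o) :=
  (forall a f h, X (Cinf_cst M a * f + h) = Cinf_cst M a * X f + X h) /\
  (forall f h, X (f * h) = X f * h + f * X h).

Definition derivationb : {pred (C -> C^o)} := fun X => `[< derivation X >].

Record vfield := MkVfield {
  vfield_fun :> C -> C^o;
  vfieldP : vfield_fun \in derivationb }.

HB.instance Definition _ := [isSub for vfield_fun].
HB.instance Definition _ := [Choice of vfield by <:].

Lemma derivationb_submod : submod_closed derivationb.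
Proof.
split; first by apply/asboolP; split => *; rewrite /= ?mulr0 ?mul0r ?addr0.
move=> u X Y /asboolP[X1 X2] /asboolP[Y1 Y2]; apply/asboolP; split.
  move=> a f h; rewrite /= !fctE X1 Y1 /GRing.scale/=.
  by rewrite !mulrDr addrACA mulrCA.
move=> f h; rewrite /= !fctE X2 Y2 /GRing.scale/=.
by rewrite !mulrDr !mulrDl addrACA mulrA [u * (f * _)]mulrCA.
Qed.
HB.instance Definition _ := GRing.isSubmodClosed.Build C (C -> C^o) derivationb
  derivationb_submod.
HB.instance Definition _ := [SubChoice_isSubLmodule of vfield by <:].

Lemma lie_derivation (X Y : vfield) :
  (fun f => X (Y f) - Y (X f)) \in derivationb.
Proof.
have /asboolP[X1 X2] := vfieldP X; have /asboolP[Y1 Y2] := vfieldP Y.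
have XD f h : X (f + h) = X f + X h.
  by have := X1 1 f h; rewrite (_ : Cinf_cst M 1 = 1) ?mul1r //; exact: val_inj.
have YD f h : Y (f + h) = Y f + Y h.
  by have := Y1 1 f h; rewrite (_ : Cinf_cst M 1 = 1) ?mul1r //; exact: val_inj.
apply/asboolP; split.
  by move=> a f h; rewrite X1 Y1 X1 Y1 opprD mulrBr addrACA.
move=> f h; rewrite X2 Y2 XD YD !X2 !Y2 mulrBl mulrBr !opprD.
ring.
Qed.

Definition lie (X Y : vfield) : vfield := MkVfield (lie_derivation X Y).

End vector_fields.

Section one_forms.
Variables (R : realType) (n : nat) (M : smooth_manifold R n).
Local Notation C := (Cinf M).
Local Notation V := (vfield M).

Definition linearb : {pred (V -> C^o)} := fun eta => `[< linear eta >].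

Record oneform := MkOneform {
  oneform_fun :> V -> C^o;
  oneformP : oneform_fun \in linearb }.

HB.instance Definition _ := [isSub for oneform_fun].
HB.instance Definition _ := [Choice of oneform by <:].

Lemma linearb_submod : submod_closed linearb.
Proof.
split.
  by apply/asboolP => a X Y; rewrite /= scaler0 addr0.
move=> u f g /asboolP lf /asboolP lg; apply/asboolP => a X Y.
rewrite /= !fctE lf lg !scalerDr !scalerA addrACA.
by rewrite (mulrC a u) -!scalerA.
Qed.
HB.instance Definition _ := GRing.isSubmodClosed.Build C (V -> C^o) linearb
  linearb_submod.
HB.instance Definition _ := [SubChoice_isSubLmodule of oneform by <:].

Definition oneform_of (f : {linear V -> C^o}) : oneform :=
  MkOneform (introT (asboolP _) (linearP f)).

Lemma oneform_is_linear (eta : oneform) : linear eta.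
Proof. exact/asboolP/oneformP. Qed.
HB.instance Definition _ (eta : oneform) :=
  GRing.isLinear.Build C V C^o *:%R eta (oneform_is_linear eta).

End one_forms.

Section connections.
Variables (R : realType) (n : nat) (M : smooth_manifold R n).
Local Notation C := (Cinf M).
Local Notation V := (vfield M).

(* Nondegeneracy is pointwise: a vector X_p that is g_p-orthogonal to every
   tangent vector at p kills every smooth function. *)
Record pseudo_metric := PseudoMetric {
  metric :> V -> V -> C;
  metric_linear : forall X, linear (metric X : V -> C^o);
  metric_sym : forall X Y, metric X Y = metric Y X;
  metric_nondegenerate : forall (p : M) (X : V),
    (forall Y, metric X Y p = 0) -> forall f : C, (X f : C) p = 0 }.

Record affine_connection := AffineConnection {
  conn :> V -> V -> V;
  conn_linear : forall Y, linear (fun X => conn X Y);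
  conn_additive : forall X Y Z, conn X (Y + Z) = conn X Y + conn X Z;
  conn_leibniz : forall X (f : C) Y,
    conn X (f *: Y) = (X f : C) *: Y + f *: conn X Y }.

Definition torsion_free (D : affine_connection) :=
  forall X Y, D X Y - D Y X = lie X Y.

Definition dual_connection (h : V -> V -> C) (D D' : affine_connection) :=
  forall X Y Z : V, (X (h Y Z) : C) = h (D X Y) Z + h Y (D' X Z).

Definition levi_civita (g : pseudo_metric) (D : affine_connection) :=
  torsion_free D /\ forall X Y Z : V, (X (g Y Z) : C) = g (D X Y) Z + g Y (D X Z).

Section affine_combination.
Variables (a b : R) (ab1 : a + b = 1) (D D' : affine_connection).

Definition mix (X Y : V) : V := Cinf_cst M a *: D X Y + Cinf_cst M b *: D' X Y.

Lemma mix_linear Y : linear (mix ^~ Y).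
Proof.
move=> u X X'; rewrite /mix !conn_linear !scalerDr !scalerA.
by rewrite ![_ * u]mulrC -!scalerA addrACA.
Qed.

Lemma mix_additive X Y Z : mix X (Y + Z) = mix X Y + mix X Z.
Proof. by rewrite /mix !conn_additive !scalerDr addrACA. Qed.

Lemma mix_leibniz X f Y : mix X (f *: Y) = (X f : C) *: Y + f *: mix X Y.
Proof.
rewrite /mix !conn_leibniz !scalerDr addrACA -scalerDl.
have -> : Cinf_cst M a + Cinf_cst M b = 1.
  by apply: val_inj; apply/funext => p; exact: ab1.
by rewrite scale1r !scalerA ![_ * f]mulrC.
Qed.

Definition mix_connection : affine_connection :=
  AffineConnection mix_linear mix_additive mix_leibniz.

End affine_combination.

Lemma alpha_weights (alpha : R) : (1 + alpha) / 2 + (1 - alpha) / 2 = 1.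
Proof. by field. Qed.

Definition alpha_connection (alpha : R) (D D' : affine_connection) :=
  mix_connection (alpha_weights alpha) D D'.

Lemma conn_oneform_linear (D : affine_connection) (X : V) (beta : oneform M) :
  (fun Y => X (beta Y) - beta (D X Y)) \in @linearb R n M.
Proof.
have /asboolP[X1 X2] := vfieldP X.
have XD f h : X (f + h) = X f + X h.
  by have := X1 1 f h; rewrite (_ : Cinf_cst M 1 = 1) ?mul1r //; exact: val_inj.
apply/asboolP => f Y Z; rewrite linearP conn_additive conn_leibniz.
rewrite !linearD !linearZ /= XD [f *: _]/GRing.scale/= X2 /GRing.scale/=.
by ring.
Qed.

Definition conn_oneform (D : affine_connection) X beta : oneform M :=
  MkOneform (conn_oneform_linear D X beta).

End connections.

Section generalized_geometry.
Variables (R : realType) (n : nat) (M : smooth_manifold R n).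
Local Notation C := (Cinf M).
Local Notation V := (vfield M).

Definition gsection := (vfield M * oneform M)%type.

Definition gbracket (D : affine_connection M) (s t : gsection) : gsection :=
  (lie s.1 t.1, conn_oneform D s.1 t.2 - conn_oneform D t.1 s.2).

Definition nijenhuis (D : affine_connection M)
    (Jh : {linear gsection -> gsection}) (s t : gsection) : gsection :=
  gbracket D (Jh s) (Jh t) - Jh (gbracket D (Jh s) t)
  - Jh (gbracket D s (Jh t)) + Jh (Jh (gbracket D s t)).

Definition g_symmetric (g : pseudo_metric M) (J : {linear V -> V}) :=
  forall X Y, g (J X) Y = g X (J Y).

Definition nabla_endo (D : affine_connection M) (J : {linear V -> V})
  (X Y : V) : V := D X (J Y) - J (D X Y).

Definition gtilde (g : pseudo_metric M) (J : {linear V -> V}) (X Y : V) : C :=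
  g X (J Y).

Definition Ftensor (g : pseudo_metric M) (D : affine_connection M)
  (J : {linear V -> V}) (X Y Z : V) : C := gtilde g J (nabla_endo D J X Y) Z.

Lemma gtilde_linear g J X : gtilde g J X \in @linearb R n M.
Proof.
by apply/asboolP => f Y Z; rewrite /gtilde linearP metric_linear.
Qed.

Definition gtilde_flat g J X : oneform M := MkOneform (gtilde_linear g J X).

Lemma gtilde_flat_linear g J : linear (gtilde_flat g J).
Proof.
move=> f X Y; apply: val_inj; apply/funext => Z /=.
rewrite /gtilde metric_sym metric_linear.
by congr (_ *: _ + _); exact: metric_sym.
Qed.
HB.instance Definition _ g J :=
  GRing.isLinear.Build C V (oneform M) *:%R (gtilde_flat g J)
    (gtilde_flat_linear g J).

Definition endo_dual (J : {linear V -> V}) (eta : oneform M) : oneform M :=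
  oneform_of (eta \o J).

Lemma endo_dual_linear J : linear (endo_dual J).
Proof. by move=> f eta beta; exact: val_inj. Qed.
HB.instance Definition _ J :=
  GRing.isLinear.Build C (oneform M) (oneform M) *:%R (endo_dual J)
    (endo_dual_linear J).

(* [gtinv] stands for the inverse of [gtilde_flat g J]. *)
Definition Jhat_minus (g : pseudo_metric M) (J : {linear V -> V})
    (gtinv : {linear oneform M -> V}) (s : gsection) : gsection :=
  (J s.1 - (gtinv s.2 + J (J (gtinv s.2))),
   gtilde_flat g J s.1 - endo_dual J s.2).

Lemma Jhat_minus_linear g J gtinv : linear (Jhat_minus g J gtinv).
Proof.
move=> f s t; rewrite [RHS]surjective_pairing /Jhat_minus.
have -> : (f *: s + t).1 = f *: s.1 + t.1 by [].
have -> : (f *: s + t).2 = f *: s.2 + t.2 by [].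
congr (_, _); rewrite !linearP /=.
  by rewrite [in LHS]addrACA -scalerDr opprD addrACA -scalerBr.
by rewrite addrACA -scalerDr.
Qed.
HB.instance Definition _ g J gtinv :=
  GRing.isLinear.Build C gsection gsection *:%R (Jhat_minus g J gtinv)
    (Jhat_minus_linear g J gtinv).

End generalized_geometry.

(* Main.v *)
(* With K = nabla^* - nabla, duality gives J K(X,Y) = (nabla_X J) Y, so K is
   symmetric by the Codazzi equation and gtilde(K(X,Y),Z) is totally symmetric.
   Passing from nabla to nabla^(alpha) adds to the bracket only the 1-form
   c gtilde(K(Y,x) - K(X,y)), where c = (1 - alpha)/2, eta = gtilde(x) and
   beta = gtilde(y).  The condition on F says K(JX,Y) = K(X,JY), under which
   the correction to the Nijenhuis tensor cancels; conversely the correction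
   at eta = beta = 0 is c gtilde(K(JY,X) - K(JX,Y)). *)
Require Import Defs.
From mathcomp Require Import all_boot all_order all_algebra.
From mathcomp Require Import reals.
From mathcomp Require Import boolp ring.

Set Implicit Arguments.
Unset Strict Implicit.
Unset Printing Implicit Defensive.

Import GRing.Theory.
Local Open Scope ring_scope.

(** * Vector fields and 1-forms as functions *)

Section function_values.
Variables (R : realType) (n : nat) (M : smooth_manifold R n).
Implicit Types (X Y : vfield M) (eta beta : oneform M) (f : Cinf M).

Lemma vfieldD X Y f : (X + Y) f = X f + Y f. Proof. by []. Qed.
Lemma vfieldN X f : (- X) f = - X f. Proof. by []. Qed.
Lemma vfield0 f : (0 : vfield M) f = 0. Proof. by []. Qed.
Definition vfieldE := (vfieldD, vfieldN, vfield0).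

Lemma vfield_ext X Y : (forall f, X f = Y f) -> X = Y.
Proof. by move=> XY; apply: val_inj; apply/funext. Qed.

Lemma oneform_ext eta beta : (forall X, eta X = beta X) -> eta = beta.
Proof. by move=> eb; apply: val_inj; apply/funext. Qed.

End function_values.

(** * Nijenhuis tensors under a change of bracket *)

Section perturbed_nijenhuis.
Variables (R : realType) (n : nat) (M : smooth_manifold R n).
Variables (D D' : affine_connection M).
Variable E : gsection M -> gsection M -> gsection M.
Hypothesis bracketE : forall s t, gbracket D' s t = gbracket D s t + E s t.

(** For fixed linear [Jh] each of the four terms is linear in the bracket. *)
Lemma nijenhuis_perturbed (Jh : {linear gsection M -> gsection M}) s t :
  nijenhuis D' Jh s t = nijenhuis D Jh s t +
    (E (Jh s) (Jh t) - Jh (E (Jh s) t) - Jh (E s (Jh t)) + Jh (Jh (E s t))).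
Proof.
rewrite /nijenhuis !bracketE !linearD /=.
rewrite (addrACA _ (E _ _)) [X in X + _ = _]addrACA.
by rewrite [LHS]addrACA.
Qed.

End perturbed_nijenhuis.

(** * The difference tensor [K] and its symmetries *)

Section codazzi_pair.
Variables (R : realType) (n : nat) (M : smooth_manifold R n).
Variables (g : pseudo_metric M) (nabla nabla_star : affine_connection M).
Variables (J : {linear vfield M -> vfield M}).
Variables (gtinv : {linear oneform M -> vfield M}).
Hypotheses (LC : levi_civita g nabla) (J_invertible : bijective J).
Hypotheses (J_symmetric : g_symmetric g J).
Hypothesis J_codazzi :
  forall X Y, nabla_endo nabla J X Y = nabla_endo nabla J Y X.
Hypothesis nabla_star_dual : dual_connection (gtilde g J) nabla nabla_star.
Hypotheses (gtinvK : cancel gtinv (gtilde_flat g J)).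
Hypotheses (gtildeK : cancel (gtilde_flat g J) gtinv).
Implicit Types (X Y Z : vfield M).

Local Notation flat := (gtilde_flat g J).

Lemma metricDr X Y Z : g X (Y + Z) = g X Y + g X Z.
Proof. by have := metric_linear g X 1 Y Z; rewrite !scale1r. Qed.

Lemma metricZr f X Y : g X (f *: Y) = f * g X Y.
Proof.
have g0 : g X 0 = 0 by apply: (addrI (g X 0)); rewrite -metricDr !addr0.
by have := metric_linear g X f Y 0; rewrite g0 !addr0.
Qed.

Lemma metricNr X Y : g X (- Y) = - g X Y.
Proof. by rewrite -scaleN1r metricZr mulN1r. Qed.

Lemma gtilde_sym X Y : gtilde g J X Y = gtilde g J Y X.
Proof. by rewrite /gtilde metric_sym J_symmetric. Qed.

(** The values [g X (J Z)] are among those compared, and [flat] is injective. *)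
Lemma metric_inj X Y : (forall Z, g X Z = g Y Z) -> X = Y.
Proof.
move=> gXY; apply: (can_inj gtildeK).
by apply: oneform_ext => Z; exact: gXY.
Qed.

Definition dual_diff X Y : vfield M := nabla_star X Y - nabla X Y.
Local Notation K := dual_diff.

Lemma dual_diffDl X Y Z : K (X + Y) Z = K X Z + K Y Z.
Proof.
have connD (D : affine_connection M) : D (X + Y) Z = D X Z + D Y Z.
  by have := conn_linear D Z 1 X Y; rewrite !scale1r.
by rewrite /K !connD opprD addrACA.
Qed.

Lemma dual_diff_endo X Y : J (K X Y) = nabla_endo nabla J X Y.
Proof.
apply: metric_inj => Z; rewrite metric_sym [RHS]metric_sym.
rewrite /K /nabla_endo linearB !metricDr !metricNr; congr (_ - _).
(* Duality and metric compatibility both expand X(g(Z, JY)); cancelling the common term leaves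
   J(nabla^*_X Y) = nabla_X(JY), paired with Z. *)
have := nabla_star_dual X Z Y; rewrite /gtilde LC.2.
by move/addrI.
Qed.

Lemma dual_diffC X Y : K X Y = K Y X.
Proof. by apply: (bij_inj J_invertible); rewrite !dual_diff_endo. Qed.

Lemma dual_diffDr X Y Z : K X (Y + Z) = K X Y + K X Z.
Proof. by rewrite !(dual_diffC X) dual_diffDl. Qed.

Lemma dual_diff0l X : K 0 X = 0.
Proof. by apply: (addrI (K 0 X)); rewrite -dual_diffDl !addr0. Qed.

Lemma dual_diff0r X : K X 0 = 0.
Proof. by rewrite dual_diffC dual_diff0l. Qed.

Lemma dual_diffNl X Y : K (- X) Y = - K X Y.
Proof.
by apply: (addrI (K X Y)); rewrite -dual_diffDl !subrr dual_diff0l.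
Qed.

Lemma dual_diffNr X Y : K X (- Y) = - K X Y.
Proof. by rewrite !(dual_diffC X) dual_diffNl. Qed.

(** Since J K(X,Y) = (nabla_X J)Y, this is the g-symmetry of nabla_X J, obtained by differentiating
    g(JY,Z) = g(Y,JZ) along X. *)
Lemma gtilde_dual_diff X Y Z : gtilde g J (K X Y) Z = gtilde g J Y (K X Z).
Proof.
have symD := LC.2 X (J Y) Z.
rewrite J_symmetric LC.2 in symD.
rewrite /gtilde -J_symmetric !dual_diff_endo /nabla_endo.
rewrite metric_sym !metricDr !metricNr ![g Z _]metric_sym.
rewrite -[g Y (J _)]J_symmetric [g (J _) Z]J_symmetric.
apply/eqP; rewrite subr_eq addrAC eq_sym subr_eq.
by rewrite addrC symD.
Qed.

(** * The correction to the bracket and to the Nijenhuis tensor *)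

Definition bracket_defect (s t : gsection M) : vfield M :=
  K t.1 (gtinv s.2) - K s.1 (gtinv t.2).

Lemma gbracket_alpha alpha s t :
  gbracket (alpha_connection alpha nabla nabla_star) s t =
  gbracket nabla s t +
    (0, Cinf_cst M ((1 - alpha) / 2) *: flat (bracket_defect s t)).
Proof.
have alphaE X Y : alpha_connection alpha nabla nabla_star X Y =
    nabla X Y + Cinf_cst M ((1 - alpha) / 2) *: K X Y.
  rewrite /= /mix /K scalerBr addrA addrAC; congr (_ + _).
  rewrite -[X in X - _]scale1r -scalerBl; congr (_ *: _).
  apply: (canRL (addrK _)); apply: val_inj; apply/funext => p.
  exact: alpha_weights.
rewrite /gbracket; congr (_, _); first by rewrite addr0.
have conn_alpha X beta :
    conn_oneform (alpha_connection alpha nabla nabla_star) X beta =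
    conn_oneform nabla X beta
    - Cinf_cst M ((1 - alpha) / 2) *: flat (K X (gtinv beta)).
  apply: oneform_ext => Z.
  change (X (beta Z) - beta (alpha_connection alpha nabla nabla_star X Z) =
    X (beta Z) - beta (nabla X Z) - Cinf_cst M ((1 - alpha) / 2) *
      gtilde g J (K X (gtinv beta)) Z).
  rewrite alphaE linearD linearZ /= opprD addrA; congr (_ - _ * _).
  (* Self-adjointness of K(X,.) for gtilde turns beta(K(X,.)) into a flat 1-form. *)
  by rewrite gtilde_dual_diff -[in LHS](gtinvK beta).
rewrite !conn_alpha /bracket_defect [flat (K _ _ - K _ _)]linearB scalerBr /=.
by rewrite opprD addrACA opprK [- _ + _]addrC.
Qed.

Lemma endo_dual_flat X : endo_dual J (flat X) = flat (J X).
Proof. by apply: oneform_ext => Z; rewrite /= /gtilde J_symmetric. Qed.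

(** Writing 1-forms as [flat x] turns the matrix into polynomials in J acting on pairs of vector
    fields. *)
Lemma Jhat_minusE X x : Jhat_minus g J gtinv (X, flat x) =
  (J X - (x + J (J x)), flat (X - J x)).
Proof. by rewrite /Jhat_minus /= gtildeK endo_dual_flat linearB. Qed.

Local Notation Jh := (Jhat_minus g J gtinv).
Local Notation defect := bracket_defect.

Lemma Jhat_flat x : Jh (0, flat x) = (- (x + J (J x)), flat (- J x)).
Proof. by rewrite Jhat_minusE (linear0 J) !sub0r. Qed.

Lemma Jhat_sqr_flat x : Jh (Jh (0, flat x)) = (0, flat (- x)).
Proof.
have JN y : J (- y) = - J y by exact: (linearN J).
rewrite Jhat_flat Jhat_minusE; congr (_, flat _).
  by rewrite !JN (linearD J) -!opprD subrr oppr0.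
by rewrite JN opprK opprD addrNK.
Qed.

(** The two middle terms of the perturbation combine into [e]; the outer two give the difference of
    defects, because the square of [Jh] is -1 on 1-forms. *)
Lemma nijenhuis_alpha alpha s t :
  let c := Cinf_cst M ((1 - alpha) / 2) in
  let e := c *: (defect (Jh s) t + defect s (Jh t)) in
  nijenhuis (alpha_connection alpha nabla nabla_star) Jh s t =
  nijenhuis nabla Jh s t +
    (e + J (J e), flat (c *: (defect (Jh s) (Jh t) - defect s t) + J e)).
Proof.
move=> c e; rewrite (nijenhuis_perturbed (gbracket_alpha alpha)) -/c.
have flatZ d : (0, c *: flat d) = (0, flat (c *: d)) :> gsection M.
  by rewrite [flat (c *: d)]linearZ.
rewrite !flatZ /= Jhat_sqr_flat !Jhat_flat {}/e.
move: (defect _ t) (defect s _) (defect _ (Jh t)) (defect s t) => d1 d2 d0 d.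
rewrite scalerDr; congr (_ + (_, _)) => /=.
  by rewrite sub0r !opprK addr0 !(linearD J) /= addrACA.
rewrite -!(linearB flat) -!(linearD flat) /=; congr (flat _).
by rewrite !opprK scalerBr (linearD J) [RHS]addrAC addrA.
Qed.

Lemma bracket_defectE X x Y y :
  defect (X, flat x) (Y, flat y) = K Y x - K X y.
Proof. by rewrite /defect /= !gtildeK. Qed.

(** * The condition on F in terms of [K] *)

Lemma Ftensor_dual_diff X Y Z :
  Ftensor g nabla J X Y Z = gtilde g J Y (K X (J Z)).
Proof.
by rewrite -gtilde_dual_diff /Ftensor -dual_diff_endo /gtilde J_symmetric.
Qed.

(** The difference of F-values is gtilde(Z, K(JX,Y) - K(X,JY)), and gtilde is nondegenerate. *)
Lemma Ftensor_symP :
  (forall X Y Z, Ftensor g nabla J Y Z X - Ftensor g nabla J X Z Y = 0) <->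
  (forall X Y, K (J X) Y = K X (J Y)).
Proof.
split=> [F0 X Y|KJ X Y Z]; last first.
  by rewrite !Ftensor_dual_diff (dual_diffC Y) KJ subrr.
apply: (can_inj gtildeK); apply: oneform_ext => Z.
rewrite /= gtilde_sym [RHS]gtilde_sym dual_diffC -!Ftensor_dual_diff.
by apply/eqP; rewrite -subr_eq0 F0.
Qed.

(** * Vanishing of the correction, and the converse *)

Section commuting.
Hypothesis KJ : forall X Y, K (J X) Y = K X (J Y).

Lemma bracket_defect_Jhat_sum s t : defect (Jh s) t + defect s (Jh t) = 0.
Proof.
case: s t => X eta [Y beta]; rewrite -(gtinvK eta) -(gtinvK beta).
move: (gtinv eta) (gtinv beta) => x y; rewrite !Jhat_minusE !bracket_defectE.
rewrite !(dual_diffDl, dual_diffDr, dual_diffNl, dual_diffNr) !KJ.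
(* With J pushed into the second slot and the arguments put in a common order, the terms cancel in
   pairs. *)
rewrite (dual_diffC Y X) !(dual_diffC y) !KJ.
apply: vfield_ext => f; rewrite !vfieldE.
ring.
Qed.

Lemma bracket_defect_Jhat s t : defect (Jh s) (Jh t) = defect s t.
Proof.
case: s t => X eta [Y beta]; rewrite -(gtinvK eta) -(gtinvK beta).
move: (gtinv eta) (gtinv beta) => x y; rewrite !Jhat_minusE !bracket_defectE.
rewrite !(dual_diffDl, dual_diffDr, dual_diffNl, dual_diffNr) !KJ.
rewrite !(dual_diffC Y) !(dual_diffC y) !KJ.
(* Evaluation at f moves the identity into a commutative ring, where [ring] applies. *)
apply: vfield_ext => f; rewrite !vfieldE.
ring.
Qed.

End commuting.

Lemma nijenhuis_alpha_invariant :
  (forall X Y eta beta alpha,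
     nijenhuis (alpha_connection alpha nabla nabla_star) Jh (X, eta) (Y, beta)
     = nijenhuis nabla Jh (X, eta) (Y, beta)) <->
  (forall X Y, K (J X) Y = K X (J Y)).
Proof.
split=> [nijE X Y|KJ X Y eta beta alpha]; last first.
  rewrite nijenhuis_alpha bracket_defect_Jhat_sum // bracket_defect_Jhat //.
  rewrite subrr !scaler0 !(linear0 J) addr0 (linear0 flat); exact: addr0.
have flat0 : 0 = flat 0 by rewrite (linear0 flat).
(* alpha = -1 makes the weight (1 - alpha)/2 equal to 1. With zero 1-forms, [e] vanishes by symmetry
   of [K], so only K(JX,Y) - K(JY,X) survives. *)
have := nijE Y X 0 0 (-1); rewrite nijenhuis_alpha flat0.
rewrite !Jhat_minusE !bracket_defectE !(linear0 J) !addr0 !subr0 !dual_diff0r.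
rewrite -[RHS]addr0 => /addrI /(congr1 snd) /= corr0.
have c1 : Cinf_cst M ((1 - -1) / 2) = 1.
  apply: val_inj; apply/funext => p.
  by change ((1 - -1) / 2 = 1 :> R); field.
have := can_inj gtildeK (etrans corr0 flat0).
rewrite c1 !scale1r !subr0 sub0r (dual_diffC Y X) subrr (linear0 J) addr0.
by move=> /eqP; rewrite subr_eq0 => /eqP ->; exact: dual_diffC.
Qed.

End codazzi_pair.

Theorem proposition5p7 (R : realType) (n : nat) (M : smooth_manifold R n)
    (g : pseudo_metric M) (nabla : affine_connection M)
    (J : {linear vfield M -> vfield M})
    (nabla_star : affine_connection M)
    (gtinv : {linear oneform M -> vfield M})
    (LC : levi_civita g nabla)
    (J_invertible : bijective J)
    (J_symmetric : g_symmetric g J)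
    (J_codazzi : forall X Y, nabla_endo nabla J X Y = nabla_endo nabla J Y X)
    (nabla_star_dual : dual_connection (gtilde g J) nabla nabla_star)
    (gtinvK : cancel gtinv (gtilde_flat g J))
    (gtildeK : cancel (gtilde_flat g J) gtinv) :
  (forall (X Y : vfield M) (eta beta : oneform M) (alpha : R),
     nijenhuis (alpha_connection alpha nabla nabla_star)
       (Jhat_minus g J gtinv) (X, eta) (Y, beta)
     = nijenhuis nabla (Jhat_minus g J gtinv) (X, eta) (Y, beta))
  <->
  (forall X Y Z : vfield M,
     Ftensor g nabla J Y Z X - Ftensor g nabla J X Z Y = 0).
Proof.
rewrite (Ftensor_symP LC J_invertible J_symmetric J_codazzi nabla_star_dual
           gtildeK).
exact: nijenhuis_alpha_invariant.
Qed.
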